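(* Let $\mathcal{A},\mathcal{B}$ be unital $C^*$-algebras and let $\varphi:\mathcal{A}^k\to\mathcal{B}$ be an invariant completely positive $k$-linear map. Then the following hold. (i) If $k=3$, then $\varphi$ is completely bounded and $\|\varphi\|_{cb}\le 2^4\|\varphi(1,1,1)\|$. (ii) If $k=4$, then $\varphi$ is completely bounded and $\|\varphi\|_{cb}\le 2^4\|\varphi(1,1,1,1)\|$.
   Context: Let $k\ge 1$, $m=\lfloor (k+1)/2\rfloor$ (so $k=2m-1$ or $k=2m$), and $\mathcal{A}^k=\mathcal{A}\times\cdots\times\mathcal{A}$ ($k$ times). A $k$-linear map $\varphi:\mathcal{A}^k\to\mathcal{B}$ is positive if $\varphi(a_1,\ldots,a_k)\ge 0$ whenever $(a_1,a_2,\ldots,a_k)=(a_k^*,a_{k-1}^*,\ldots,a_1^* )$, with the additional assumption $a_m\ge 0$ when $k$ is odd. For $t\in\mathbb{N}$, the $t$-amplification of $\varphi$ is the $k$-linear map $\varphi_t:M_t(\mathcal{A})^k\to M_t(\mathcal{B})$ whose value at $(A_1,\ldots,A_k)$, $A_l=[a_{l,ij}]$, has $(i,j)$ entry $\sum_{r_1,\ldots,r_{k-1}=1}^t\varphi(a_{1,ir_1},a_{2,r_1r_2},\ldots,a_{k,r_{k-1}j})$. The map $\varphi$ is completely positive if $\varphi_t$ is positive for every $t\in\mathbb{N}$. It is completely bounded if $\|\varphi\|_{cb}:=\sup_{t\in\mathbb{N}}\|\varphi_t\|<\infty$, where $\|\varphi_t\|=\sup\{\|\varphi_t(A_1,\ldots,A_k)\|:\|A_l\|\le1,\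 1\le l\le k\}$. A $k$-linear map $\varphi:\mathcal{A}^k\to\mathcal{B}$ is invariant if: when $k=2m-1$, $\varphi(a_1c_1,\ldots,a_{m-1}c_{m-1},a_m,a_{m+1},\ldots,a_{2m-1})=\varphi(a_1,\ldots,a_{m-1},a_m,c_{m-1}a_{m+1},\ldots,c_1a_{2m-1})$ for all $a_1,\ldots,a_{2m-1},c_1,\ldots,c_{m-1}\in\mathcal{A}$; when $k=2m$, $\varphi(a_1c_1,\ldots,a_mc_m,a_{m+1},\ldots,a_{2m})=\varphi(a_1,\ldots,a_m,c_ma_{m+1},\ldots,c_1a_{2m})$ for all $a_1,\ldots,a_{2m},c_1,\ldots,c_m\in\mathcal{A}$. *)

(* Defs.v *)
From HB Require Import structures.
From mathcomp Require Import all_boot all_order all_algebra complex.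
From mathcomp Require Import all_classical all_reals all_analysis.
Import Order.TTheory GRing.Theory Num.Theory.
Import numFieldNormedType.Exports.

Set Implicit Arguments.
Unset Strict Implicit.
Unset Printing Implicit Defensive.

Local Open Scope classical_set_scope.
Local Open Scope ring_scope.

HB.mixin Record PzRing_isStarRing A of GRing.PzRing A := {
  star : A -> A;
  starK : involutive star;
  starD : {morph star : x y / x + y};
  starM : forall x y, star (x * y) = star y * star x
}.

#[short(type="starRingType")]
HB.structure Definition StarRing := {A of GRing.PzRing A & PzRing_isStarRing A}.

(* The algebra structure is given on top of the normed module, not as a join of
   PzRing and CompleteNormedModule: Hierarchy Builder rejects that join because
   numDomainType already inherits from both normed modules and rings. 1 = 0 is
   allowed, as the zero algebra is a unital C*-algebra. The norm of a normed
   module over R[i] takes its values in R[i]. *)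
Record cstarAlgType (R : realType) := CStarAlgebra {
  cstar_space : completeNormedModType R[i];
  cstar_one : cstar_space;
  cstar_mul : cstar_space -> cstar_space -> cstar_space;
  cstar_star : cstar_space -> cstar_space;
  cstar_mulA : associative cstar_mul;
  cstar_mul1 : left_id cstar_one cstar_mul;
  cstar_mulr1 : right_id cstar_one cstar_mul;
  cstar_mulDl : left_distributive cstar_mul +%R;
  cstar_mulDr : right_distributive cstar_mul +%R;
  cstar_scaleAl : forall (c : R[i]) x y,
    c *: cstar_mul x y = cstar_mul (c *: x) y;
  cstar_scaleAr : forall (c : R[i]) x y,
    c *: cstar_mul x y = cstar_mul x (c *: y);
  cstar_starK : involutive cstar_star;
  cstar_starD : {morph cstar_star : x y / x + y};
  cstar_starZ : forall (c : R[i]) x,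
    cstar_star (c *: x) = (c^*)%C *: cstar_star x;
  cstar_starM : forall x y,
    cstar_star (cstar_mul x y) = cstar_mul (cstar_star y) (cstar_star x);
  cstar_normM : forall x y, `|cstar_mul x y| <= `|x| * `|y|;
  cstar_identity : forall x, `|cstar_mul (cstar_star x) x| = `|x| ^+ 2
}.

Definition cstar_sort (R : realType) (A : cstarAlgType R) : Type :=
  cstar_space A.
Coercion cstar_sort : cstarAlgType >-> Sortclass.

Section CStarInstances.
Variables (R : realType) (A : cstarAlgType R).

HB.instance Definition _ :=
  CompleteNormedModule.copy (cstar_sort A) (cstar_space A).

HB.instance Definition _ := GRing.Zmodule_isPzRing.Build (cstar_sort A)
  (@cstar_mulA R A) (@cstar_mul1 R A) (@cstar_mulr1 R A)
  (@cstar_mulDl R A) (@cstar_mulDr R A).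

HB.instance Definition _ := PzRing_isStarRing.Build (cstar_sort A)
  (@cstar_starK R A) (@cstar_starD R A) (@cstar_starM R A).

End CStarInstances.

Definition adjmx (A : starRingType) m n (M : 'M[A]_(m, n)) : 'M[A]_(n, m) :=
  map_mx star M^T.

Section MatrixStarRing.
Variables (A : starRingType).

Lemma star0 : star (0 : A) = 0.
Proof. by apply: (addrI (star 0)); rewrite -starD !addr0. Qed.

Lemma star_sum I (r : seq I) (P : pred I) (F : I -> A) :
  star (\sum_(i <- r | P i) F i) = \sum_(i <- r | P i) star (F i).
Proof. exact: (big_morph _ (@starD A) star0). Qed.

Lemma adjmxK m n : cancel (@adjmx A m n) (@adjmx A n m).
Proof. by move=> M; apply/matrixP => i j; rewrite !mxE starK. Qed.

Lemma adjmxD m n : {morph @adjmx A m n : M N / M + N}.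
Proof. by move=> M N; apply/matrixP => i j; rewrite !mxE starD. Qed.

Lemma adjmxM m n p (M : 'M[A]_(m, n)) (N : 'M[A]_(n, p)) :
  adjmx (M *m N) = adjmx N *m adjmx M.
Proof.
apply/matrixP => i j; rewrite !mxE star_sum; apply: eq_bigr => l _.
by rewrite !mxE starM.
Qed.

HB.instance Definition _ n := PzRing_isStarRing.Build 'M[A]_n
  (@adjmxK n n) (@adjmxD n n) (@adjmxM n n n).

End MatrixStarRing.

(* In a C*-algebra, and in the C*-algebra 'M[A]_t of matrices over one, these
   are the elements x >= 0. *)
Definition star_positive (A : starRingType) (x : A) : Prop :=
  exists y : A, x = star y * y.

Section CStarNorm.
Variables (R : realType) (A : cstarAlgType R).

Definition cnorm (x : A) : R := complex.Re `|x|.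

(* The norm of the Hilbert A-module A^t, with <x, y> = \sum_i x_i^* y_i. *)
Definition colnorm t (x : 'cV[A]_t) : R :=
  Num.sqrt (cnorm ((adjmx x *m x) ord0 ord0)).

(* The C*-norm of M_t(A): the operator norm for the (faithful) action of M_t(A)
   by left multiplication on A^t. The supremum is finite. *)
Definition mxcnorm t (M : 'M[A]_t) : \bar R :=
  ereal_sup [set (colnorm (M *m x))%:E | x in [set x | colnorm x <= 1]].

End CStarNorm.

Section MultilinearMaps.
Variable k : nat.

Definition multilinear (K : pzRingType) (U V : lmodType K)
    (f : {ffun 'I_k -> U} -> V) : Prop :=
  forall (i : 'I_k) (a : {ffun 'I_k -> U}),
    linear (fun x => f (finfun [eta a with i |-> x])).

(* Indices of 'I_k start at 0, so that rev_ord exchanges a_l and a_(k+1-l), and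
   a_m with m = floor((k+1)/2) is the entry of index i with i.+1 = m. *)
Definition positive_map (U V : starRingType)
    (f : {ffun 'I_k -> U} -> V) : Prop :=
  forall a : {ffun 'I_k -> U},
    (forall i, a i = star (a (rev_ord i))) ->
    (odd k -> forall i : 'I_k, i.+1 = k.+1./2 -> star_positive (a i)) ->
    star_positive (f a).

(* The factor of index l has row index r_l and column index r_(l+1) (counted
   from 1), where r_0 and r_k stand for i and j: these are the entries of index
   l in the sequences i, r_1, ..., r_(k-1) and r_1, ..., r_(k-1), j. *)
Definition amplification (U V : nmodType) (f : {ffun 'I_k -> U} -> V) t
    (M : {ffun 'I_k -> 'M[U]_t}) : 'M[V]_t :=
  \matrix_(i, j) \sum_(r : k.-1.-tuple 'I_t)
    f [ffun l : 'I_k => M l (nth i (i :: r) l) (nth j (rcons r j) l)].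

Definition completely_positive (U V : starRingType)
    (f : {ffun 'I_k -> U} -> V) : Prop :=
  forall t, (0 < t)%N -> positive_map (@amplification U V f t).

(* Both parities at once: the first floor(k/2) arguments are multiplied on the
   right by the c_l, the last floor(k/2) on the left by the same c_l in reverse
   order, and the middle one, when k is odd, is unchanged. The other entries of
   c do not occur. *)
Definition invariant_map (U : pzRingType) (V : Type)
    (f : {ffun 'I_k -> U} -> V) : Prop :=
  forall a c : {ffun 'I_k -> U},
    f [ffun i : 'I_k => if (i < k./2)%N then a i * c i else a i] =
    f [ffun i : 'I_k =>
         if (rev_ord i < k./2)%N then c (rev_ord i) * a i else a i].

Section CompletelyBounded.
Variables (R : realType) (A B : cstarAlgType R) (f : {ffun 'I_k -> A} -> B).

Definition ampnorm t : \bar R :=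
  ereal_sup [set mxcnorm (amplification f M) |
    M in [set M : {ffun 'I_k -> 'M[A]_t} | forall l, (mxcnorm (M l) <= 1)%E]].

Definition cbnorm : \bar R :=
  ereal_sup [set ampnorm t | t in [set t | (0 < t)%N]].

Definition completely_bounded : Prop := (cbnorm < +oo)%E.

End CompletelyBounded.
End MultilinearMaps.

(* Main.v *)
From HB Require Import structures.
Require Import Defs.
From mathcomp Require Import all_boot all_order all_algebra complex.
From mathcomp Require Import all_classical all_reals all_analysis.
From mathcomp Require Import ring lra.
Import Order.TTheory GRing.Theory Num.Theory.
Import numFieldNormedType.Exports.

(* Order in a C*-algebra: call a self-adjoint h positive when ||r - h|| <= r for
   some r >= 0. Square roots of 1 - h come from the iteration y := (h + y^2) / 2,
   unitaries s + i k give norm estimates for commuting self-adjoint elements, and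
   from these 0 <= h <= g implies ||h|| <= ||g|| and (Kaplansky) x^* x is
   positive. Hence A^t is a Hilbert module and Cauchy-Schwarz holds for it.

   By invariance phi(a, b, c) = psi(b, a c), respectively
   phi(a, b, b', c) = psi(b b', a c), so that both amplifications have the form
   T(X, P, Y) with T(Z^*, F^* F, Z) >= 0. Polarizing first in (X^*, Y) and then
   in P = 1^* P leaves the terms Z = X^* + u Y and F = 1 + v P with u^4 = v^4 = 1.
   For contractions X, P, Y both 4 - Z^* Z and 4 - F^* F are sums of squares, so
   T(Z^*, F^* F, Z) <= 4 T(Z^*, 1, Z) = 4 T(1, 1, Z^* Z) <= 16 T(1, 1, 1) =
   16 phi(1, ..., 1). Each polarization is an average of four terms, hence the
   constant 16. *)

Set Implicit Arguments.
Unset Strict Implicit.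
Unset Printing Implicit Defensive.

Local Open Scope classical_set_scope.
Local Open Scope ring_scope.

(** * The norm of a C*-algebra *)

Lemma star1 (E : starRingType) : star (1 : E) = 1.
Proof. by rewrite -[LHS]mulr1 -{2}(starK 1) -starM mulr1 starK. Qed.

Lemma starN (E : starRingType) : {morph @star E : x / - x}.
Proof. by move=> x; apply: (addrI (star x)); rewrite -starD !subrr star0. Qed.

Lemma starB (E : starRingType) : {morph @star E : x y / x - y}.
Proof. by move=> x y; rewrite starD starN. Qed.

Section CNorm.
Variables (R : realType) (A : cstarAlgType R).
Implicit Types (x y z : A) (c : R[i]) (r : R).

Lemma scalemulAl c x y : c *: (x * y) = c *: x * y.
Proof. exact: cstar_scaleAl. Qed.

Lemma scalemulAr c x y : c *: (x * y) = x * (c *: y).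
Proof. exact: cstar_scaleAr. Qed.

Lemma starZ c x : star (c *: x) = (c^*)%C *: star x.
Proof. exact: cstar_starZ. Qed.

Lemma starZr r x : star (r%:C%C *: x) = r%:C%C *: star x.
Proof. by rewrite starZ conjc_real. Qed.

Lemma normcE x : `|x| = (cnorm x)%:C%C.
Proof.
have := normr_ge0 x; rewrite /cnorm; case: `|x| => a b.
by rewrite lecE /= => /andP[/eqP-> _].
Qed.

Lemma cnorm_ge0 x : 0 <= cnorm x.
Proof. by rewrite -lecR -normcE normr_ge0. Qed.

Lemma cnorm0 : cnorm (0 : A) = 0.
Proof. by rewrite /cnorm normr0. Qed.

Lemma cnorm_eq0 x : cnorm x = 0 -> x = 0.
Proof. by move=> h; apply: normr0_eq0; rewrite normcE h. Qed.

Lemma cnormN x : cnorm (- x) = cnorm x.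
Proof. by rewrite /cnorm normrN. Qed.

Lemma cnormB x y : cnorm (x - y) = cnorm (y - x).
Proof. by rewrite -cnormN opprB. Qed.

Lemma cnormD x y : cnorm (x + y) <= cnorm x + cnorm y.
Proof. by rewrite -lecR rmorphD /= -!normcE ler_normD. Qed.

Lemma cnormM x y : cnorm (x * y) <= cnorm x * cnorm y.
Proof. by rewrite -lecR rmorphM /= -!normcE; exact: cstar_normM. Qed.

Lemma cnormZ c x : cnorm (c *: x) = complex.Re `|c| * cnorm x.
Proof. by rewrite /cnorm normrZ normcE normc_def /= mul0r subr0. Qed.

Lemma cnormZr r x : cnorm (r%:C%C *: x) = `|r| * cnorm x.
Proof. by rewrite cnormZ normc_def /= expr0n addr0 sqrtr_sqr. Qed.

Lemma cnorm_starM x : cnorm (star x * x) = cnorm x ^+ 2.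
Proof.
have := @cstar_identity R A x; rewrite -/(star x * x).
by rewrite !normcE -rmorphXn => /(congr1 (@complex.Re R)).
Qed.

(** The C*-identity and submultiplicativity give [cnorm y ^+ 2 <= cnorm (star y) * cnorm y].
    Cancelling yields one inequality; the other is the same one at [star y]. *)
Lemma cnorm_star x : cnorm (star x) = cnorm x.
Proof.
have le y : cnorm y <= cnorm (star y).
  have := cnormM (star y) y; rewrite cnorm_starM expr2.
  have [/eqP->|] := boolP (cnorm y == 0); first by rewrite cnorm_ge0.
  by move=> y0; rewrite ler_pM2r // lt_def y0 cnorm_ge0.
by apply/le_anti; rewrite le -{2}(starK x) le.
Qed.

(** By the C*-identity the norm of 1 equals its square, so it is 0 or 1; the value 0 occurs in the
    zero algebra. *)
Lemma cnorm1_le1 : cnorm (1 : A) <= 1.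
Proof.
have := cnorm_starM 1; rewrite star1 mulr1 => h.
by have := cnorm_ge0 1; nra.
Qed.

Lemma cnorm_sum I (s : seq I) (P : pred I) (F : I -> A) :
  cnorm (\sum_(i <- s | P i) F i) <= \sum_(i <- s | P i) cnorm (F i).
Proof.
elim/big_rec2: _ => [|i a b _ h]; first by rewrite cnorm0.
by apply: le_trans (cnormD _ _) _; rewrite lerD2l.
Qed.

(** Telescoping against the bounded scalar sequence [q] makes [u] Cauchy; the tail of [q] then
    serves as an explicit error bound. *)
Lemma cauchy_limit (u : nat -> A) (q : nat -> R) (M : R) :
    (forall n, cnorm (u n.+1 - u n) <= q n.+1 - q n) ->
    (forall n, q n <= M) ->
  exists l, forall n, cnorm (l - u n) <= sup (range q) - q n.
Proof.
move=> du qM; pose L := sup (range q).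
have hs : has_sup (range q).
  by split; [exists (q 0%N); exists 0%N | exists M => _ [n _ <-]].
have qL n : q n <= L by apply: sup_upper_bound => //; exists n.
have tele m n : (m <= n)%N -> cnorm (u n - u m) <= q n - q m.
  elim: n => [|n IH]; first by rewrite leqn0 => /eqP->; rewrite !subrr cnorm0.
  rewrite leq_eqVlt => /predU1P[->|/IH h]; first by rewrite !subrr cnorm0.
  rewrite -[u n.+1](subrK (u n)) -addrA; apply: le_trans (cnormD _ _) _.
  by have := du n; lra.
have near (e : R) : 0 < e -> exists N, L - q N < e.
  by move=> /sup_adherent-/(_ _ hs)[_ [N _ <-]] h; exists N; rewrite ltrBlDl -ltrBlDr.
have ltE (e : R[i]) x : 0 < e -> cnorm x < complex.Re e -> `|x| < e.
  by rewrite normcE !ltcE /= => /andP[/eqP-> _] ->; rewrite eqxx.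
have cu : cauchy (u @ \oo).
  apply: cauchy_exP => e e0; have e0' : 0 < complex.Re e.
    by move: e0; rewrite ltcE => /andP[].
  have [N hN] := near _ e0'; exists (u N).
  exists N => // n /= Nn; rewrite -ball_normE /ball_ /=; apply: ltE => //.
  by rewrite cnormB; apply: le_lt_trans (tele _ _ Nn) _; have := qL n; lra.
have /cvg_ex[l hl] : cvg (u @ \oo) by exact: cauchy_cvg.
exists l => n; apply/ler_addgt0Pl => e e0.
have e0' : 0 < (e%:C%C : R[i]) by rewrite ltcE /= eqxx.
have [N _ hN] := cvgr_dist_lt _ _ hl _ e0'.
have := hN (maxn N n) (leq_maxl _ _).
rewrite normcE ltcE /= eqxx /= => h.
(* The limit is compared with [u n] through a later term that is [e]-close to it. *)
rewrite -[l](subrK (u (maxn N n))) -addrA.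
apply: le_trans (cnormD _ _) _.
have := tele _ _ (leq_maxr N n); have := qL (maxn N n); rewrite /L; lra.
Qed.

End CNorm.

(** * Square roots in complete normed star rings *)

(* [bnd x c] stands for "the norm of x is at most c"; only upper bounds occur,
   so that matrices over a C*-algebra need no norm function. *)
Record complete_bound (R : realType) (E : starRingType) (bnd : E -> R -> Prop)
    (half : E) (K : R) : Prop := CompleteBound {
  bnd0 : bnd 0 0;
  bndD : forall x y c d, bnd x c -> bnd y d -> bnd (x + y) (c + d);
  bndM : forall x y c d, 0 <= c -> bnd x c -> bnd y d -> bnd (x * y) (c * d);
  bndN : forall x c, bnd x c -> bnd (- x) c;
  bnd_star : forall x c, 0 <= c -> bnd x c -> bnd (star x) c;
  bnd_le : forall x c d, bnd x c -> c <= d -> bnd x d;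
  bnd_ex : forall x, exists2 c, 0 <= c & bnd x c;
  bnd_sep : forall x, (forall e, 0 < e -> bnd x e) -> x = 0;
  half_add : half + half = 1;
  half_comm : forall x, half * x = x * half;
  half_star : star half = half;
  bnd_half : bnd half 2^-1;
  bnd_ge0 : 0 <= K;
  bnd_limit : forall (u : nat -> E) (q : nat -> R) M,
    (forall n, bnd (u n.+1 - u n) (q n.+1 - q n)) -> (forall n, q n <= M) ->
    exists l, forall n, bnd (l - u n) (K * (sup (range q) - q n))
}.

Section SquareRoot.
Variables (R : realType) (E : starRingType) (bnd : E -> R -> Prop).
Variables (half : E) (K : R) (bndP : complete_bound bnd half K).
Variables (h : E) (h_star : star h = h) (h1 : bnd h 1).

(* The fixed point y = (h + y^2) / 2 is 1 - sqrt (1 - h); the scalar iteration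
   with h = 1 majorizes the one for h. *)
Fixpoint sqrt_iter n : E :=
  if n is m.+1 then half * (h + sqrt_iter m * sqrt_iter m) else 0.

Fixpoint sqrt_major n : R :=
  if n is m.+1 then (1 + sqrt_major m ^+ 2) / 2 else 0.

Lemma sqrt_major01 n : 0 <= sqrt_major n <= 1.
Proof.
elim: n => [|n /andP[q0 q1]] /=; first by rewrite lexx ler01.
by apply/andP; split; nra.
Qed.

Lemma sqrt_major_incr n : sqrt_major n <= sqrt_major n.+1.
Proof. by have := sqr_ge0 (1 - sqrt_major n); rewrite /=; nra. Qed.

(** A difference of squares factors without commutativity as [y' * (y' - y) + (y' - y) * y], and the
    majorant obeys the same identity; so the bounds on iterates and on increments propagate
    together. *)
Lemma bnd_iter n : bnd (sqrt_iter n) (sqrt_major n) /\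
  bnd (sqrt_iter n.+1 - sqrt_iter n) (sqrt_major n.+1 - sqrt_major n).
Proof.
have b0 := bnd0 bndP.
elim: n => [|n [IH1 IH2]].
  split=> //=; rewrite mul0r addr0 !subr0 expr0n addr0.
  rewrite mulrC; apply: (bndM bndP) h1; first by rewrite invr_ge0.
  exact: (bnd_half bndP).
have /andP[q0 q1] := sqrt_major01 n; have /andP[q0' q1'] := sqrt_major01 n.+1.
have bS : bnd (sqrt_iter n.+1) (sqrt_major n.+1).
  rewrite -[sqrt_iter n.+1](subrK (sqrt_iter n)) -[sqrt_major n.+1](subrK (sqrt_major n)).
  exact: (bndD bndP).
split => //.
have -> : sqrt_iter n.+2 - sqrt_iter n.+1 =
    half * (sqrt_iter n.+1 * (sqrt_iter n.+1 - sqrt_iter n) +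
            (sqrt_iter n.+1 - sqrt_iter n) * sqrt_iter n).
  rewrite mulrBr mulrBl addrA subrK.
  rewrite -[sqrt_iter n.+2]/(half * (h + sqrt_iter n.+1 * sqrt_iter n.+1)).
  rewrite -[X in _ - X = _]/(half * (h + sqrt_iter n * sqrt_iter n)).
  by rewrite -mulrBr opprD addrACA subrr add0r.
have -> : sqrt_major n.+2 - sqrt_major n.+1 = 2^-1 * (sqrt_major n.+1 *
    (sqrt_major n.+1 - sqrt_major n) + (sqrt_major n.+1 - sqrt_major n) * sqrt_major n).
  rewrite -[sqrt_major n.+2]/((1 + sqrt_major n.+1 ^+ 2) / 2).
  rewrite -[X in _ - X = _]/((1 + sqrt_major n ^+ 2) / 2).
  by field.
apply: (bndM bndP); [by rewrite invr_ge0 | exact: (bnd_half bndP) |].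
apply: (bndD bndP); apply: (bndM bndP) => //.
by rewrite subr_ge0 sqrt_major_incr.
Qed.

(** The root is [1 - y] for the limit [y] of the iteration. Iterates are self-adjoint and commute
    with whatever commutes with [h]. These properties and the fixed point equation pass to [y],
    since the discrepancy is bounded by a multiple of [L - sqrt_major n], which becomes arbitrarily
    small. *)
Lemma ring_sqrt : exists s, [/\ star s = s, s * s = 1 - h, bnd (1 - s) K &
  forall g, g * h = h * g -> g * s = s * g].
Proof.
pose L := sup (range sqrt_major).
have hs : has_sup (range sqrt_major).
  split; [by exists 0; exists 0%N | exists 1 => _ [n _ <-]].
  by have /andP[] := sqrt_major01 n.
have qL n : sqrt_major n <= L by apply: sup_upper_bound => //; exists n.
have L1 : L <= 1.
  by apply: sup_le_ub; [case: hs|move=> _ [n _ <-]; have /andP[] := sqrt_major01 n].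
have near (e : R) : 0 < e -> exists N, L - sqrt_major N < e.
  by move=> /sup_adherent-/(_ _ hs)[_ [N _ <-]] lt; exists N; rewrite ltrBlDl -ltrBlDr.
have sep C x : 0 <= C -> (forall n, bnd x (C * (L - sqrt_major n))) -> x = 0.
  move=> C0 hx; apply: (bnd_sep bndP) => e e0.
  (* Dividing by [C + 1] instead of [C] covers [C = 0]. *)
  have [|N hN] := near (e / (C + 1)); first by apply: divr_gt0 => //; lra.
  apply: (bnd_le bndP) (hx N) _; move: hN; rewrite ltr_pdivlMr; last lra.
  by have := qL N; nra.
have [|n|y hy] := bnd_limit bndP (u := sqrt_iter) (q := sqrt_major) (M := 1).
- by move=> n; have [] := bnd_iter n.
- by have /andP[] := sqrt_major01 n.
rewrite -/L in hy.
have K0 := bnd_ge0 bndP.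
have d0 n : 0 <= K * (L - sqrt_major n) by rewrite mulr_ge0 // subr_ge0.
have [Y Y0 bY] := bnd_ex bndP y.
have fixy : y = half * (h + y * y).
  apply/eqP; rewrite -subr_eq0; apply/eqP.
  (* With [q] for [sqrt_major], the errors add up to [K (L - q_(n+1)) + (q_n K (L - q_n) + K (L -
     q_n) Y) / 2]; since [q_n <= q_(n+1)] and [q_n <= 1], this is at most the given multiple of
     [L - q_n]. *)
  apply: (sep (K * (1 + 2^-1 * (1 + Y)))) => [|n]; first by apply: mulr_ge0 => //; lra.
  have -> : y - half * (h + y * y) = (y - sqrt_iter n.+1) -
     half * (sqrt_iter n * (y - sqrt_iter n) + (y - sqrt_iter n) * y).
    rewrite mulrBr mulrBl (addrC (_ - sqrt_iter n * _)) addrA subrK.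
    rewrite -[sqrt_iter n.+1]/(half * (h + sqrt_iter n * sqrt_iter n)).
    by rewrite -addrA -opprD -mulrDr addrACA subrr addr0.
  have := bndD bndP (hy n.+1) (bndN bndP (bndM bndP _ (bnd_half bndP)
    (bndD bndP (bndM bndP _ (bnd_iter n).1 (hy n)) (bndM bndP (d0 n) (hy n) bY)))).
  have /andP[q0 q1] := sqrt_major01 n.
  move=> /(_ _ q0) bnd2; apply: (bnd_le bndP (bnd2 _)); first by rewrite invr_ge0.
  have := sqrt_major_incr n; have := d0 n; have := d0 n.+1.
  have : K * sqrt_major n <= K * sqrt_major n.+1 by rewrite ler_wpM2l // sqrt_major_incr.
  by nra.
exists (1 - y); split.
- rewrite starB star1; congr (1 - _); apply/eqP; rewrite -subr_eq0; apply/eqP.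
  have us n : star (sqrt_iter n) = sqrt_iter n.
    elim: n => [|n IH] /=; first exact: star0.
    by rewrite starM starD starM IH h_star (half_star bndP) (half_comm bndP).
  apply: (sep (K + K)) => [|n]; first by rewrite addr_ge0.
  have -> : star y - y = star (y - sqrt_iter n) - (y - sqrt_iter n).
    by rewrite starB us opprB addrA subrK.
  by rewrite mulrDl; apply: (bndD bndP); [apply: (bnd_star bndP) | apply: (bndN bndP)].
- have hyy : y + y = h + y * y by rewrite {1 2}fixy -mulrDl (half_add bndP) mul1r.
  rewrite mulrBl mul1r mulrBr mulr1 opprB -addrA; congr (1 + _).
  by rewrite addrCA -opprD hyy opprD addrCA subrr addr0.
- rewrite subKr; apply: (bnd_le bndP (c := K * (L - sqrt_major 0))).
    by have := hy 0%N; rewrite subr0.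
  by rewrite /= subr0; nra.
- move=> g gh; rewrite mulrBr mulrBl mulr1 mul1r; congr (_ - _).
  apply/eqP; rewrite -subr_eq0; apply/eqP.
  have ug n : g * sqrt_iter n = sqrt_iter n * g.
    elim: n => [|n IH] /=; first by rewrite mulr0 mul0r.
    by rewrite mulrA -(half_comm bndP) -!mulrA; congr (half * _);
      rewrite mulrDl mulrDr gh mulrA IH -!mulrA IH.
  have [G G0 bG] := bnd_ex bndP g.
  apply: (sep (G * K + K * G)) => [|n]; first by rewrite addr_ge0 ?mulr_ge0.
  have -> : g * y - y * g = g * (y - sqrt_iter n) - (y - sqrt_iter n) * g.
    by rewrite mulrBl mulrBr ug opprB addrA subrK.
  rewrite [X in bnd _ X]mulrDl; apply: (bndD bndP).
    by rewrite -mulrA; apply: (bndM bndP).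
  by apply: (bndN bndP); rewrite [X in bnd _ X]mulrAC; apply: (bndM bndP).
Qed.

End SquareRoot.

(** * Positive elements *)

Section Positivity.
Variables (R : realType) (A : cstarAlgType R).
Implicit Types (h k s x y z : A) (r : R).

Lemma scale_realA r r' x : r%:C%C *: (r'%:C%C *: x) = (r * r')%:C%C *: x.
Proof. by rewrite scalerA rmorphM. Qed.

Lemma addr2Z x : x + x = 2%:C%C *: x.
Proof. by rewrite (_ : 2 = 1 + 1 :> R) // rmorphD scalerDl scale1r. Qed.

Lemma conjii : ('i^*)%C = - 'i%C :> R[i].
Proof. by apply/eqP; rewrite eq_complex /= oppr0 !eqxx. Qed.

Lemma mulii : 'i%C * 'i%C = -1 :> R[i].
Proof. by rewrite -expr2 sqr_i. Qed.

Lemma cnorm_complete_bound :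
  complete_bound (fun (x : A) (c : R) => cnorm x <= c) ((2^-1 : R)%:C%C *: (1 : A)) 1.
Proof.
split => //.
- by rewrite cnorm0.
- by move=> x y c d hx hy; apply: le_trans (cnormD _ _) (lerD hx hy).
- move=> x y c d c0 hx hy; apply: le_trans (cnormM _ _) _.
  by apply: ler_pM; rewrite ?cnorm_ge0.
- by move=> x c; rewrite cnormN.
- by move=> x c _; rewrite cnorm_star.
- by move=> x c d; exact: le_trans.
- by move=> x; exists (cnorm x); rewrite ?cnorm_ge0.
- move=> x hx; apply: cnorm_eq0; apply: le_anti; rewrite cnorm_ge0 andbT.
  by apply/ler_addgt0Pl => e e0; rewrite addr0 hx.
- by rewrite addr2Z scale_realA divff // scale1r.
- by move=> x; rewrite -scalemulAl -scalemulAr mul1r mulr1.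
- by rewrite starZr star1.
- rewrite cnormZr ger0_norm ?invr_ge0 //.
  by have := cnorm1_le1 A; have := cnorm_ge0 (1 : A); lra.
- move=> u q M hu hq; have [l hl] := cauchy_limit hu hq.
  by exists l => n; rewrite mul1r.
Qed.

Lemma cstar_sqrt h : star h = h -> cnorm h <= 1 ->
  exists s, [/\ star s = s, s * s = 1 - h, cnorm (1 - s) <= 1 &
    forall g, g * h = h * g -> g * s = s * g].
Proof. exact: ring_sqrt cnorm_complete_bound _. Qed.

(* Because s + i k is unitary. *)
Lemma cnorm_le1_unitary s k : star s = s -> star k = k -> s * k = k * s ->
  s * s + k * k = 1 -> cnorm s <= 1.
Proof.
move=> ss ks sk e; pose u : A := s + 'i%C *: k.
have su : star u = s - 'i%C *: k.
  by rewrite starD starZ ss ks conjii scaleNr.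
have uu : star u * u = 1.
  rewrite su mulrDr !mulrBl -!scalemulAl -!scalemulAr scalerA sk.
  rewrite mulii scaleN1r opprK.
  by rewrite addrA subrK.
have u1 : cnorm u <= 1.
  have := cnorm_starM u; rewrite uu; have := cnorm1_le1 A; have := cnorm_ge0 u.
  by nra.
have /(congr1 (@cnorm R A)) : s + s = u + star u by rewrite su addrACA subrr addr0.
have := cnormD u (star u); rewrite cnorm_star addr2Z cnormZr ger0_norm //.
lra.
Qed.

Definition pos h : Prop :=
  star h = h /\ exists2 r, 0 <= r & cnorm (r%:C%C *: (1 : A) - h) <= r.

(** The triangle inequality and [cnorm 1 <= 1] let the radius grow. A nonzero radius is wanted when
    [h] is divided by it. *)
Lemma pos_radius h r : 0 <= r -> pos h -> exists2 r',
  r <= r' & cnorm (r'%:C%C *: (1 : A) - h) <= r'.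
Proof.
move=> r0 [hs [r1 r10 hr]]; exists (r + r1); first by rewrite lerDl.
rewrite rmorphD /= scalerDl -addrA; apply: le_trans (cnormD _ _) _.
rewrite cnormZr ger0_norm //; have := cnorm1_le1 A; have := cnorm_ge0 (1 : A).
by nra.
Qed.

Lemma pos0 : pos 0.
Proof. by split; [exact: star0 | exists 0; rewrite // scale0r subr0 cnorm0]. Qed.

Lemma posD h k : pos h -> pos k -> pos (h + k).
Proof.
move=> [hs [r r0 hr]] [ks [r' r'0 kr]]; split; first by rewrite starD hs ks.
exists (r + r'); first exact: addr_ge0.
rewrite rmorphD /= scalerDl opprD addrACA.
by apply: le_trans (cnormD _ _) (lerD hr kr).
Qed.

Lemma pos_sum I (l : seq I) (P : pred I) (F : I -> A) :
  (forall i, P i -> pos (F i)) -> pos (\sum_(i <- l | P i) F i).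
Proof. by move=> hF; elim/big_ind: _ => //; [exact: pos0 | exact: posD]. Qed.

Lemma posZ r h : 0 <= r -> pos h -> pos (r%:C%C *: h).
Proof.
move=> r0 [hs [r' r'0 hr]]; split; first by rewrite starZr hs.
exists (r * r'); first exact: mulr_ge0.
by rewrite -scale_realA -scalerBr cnormZr ger0_norm // ler_wpM2l.
Qed.

Lemma pos_sub r h : star h = h -> cnorm h <= r -> pos (r%:C%C *: (1 : A) - h).
Proof.
move=> hs hr; split; first by rewrite starB starZr star1 hs.
exists r; first by apply: le_trans hr; exact: cnorm_ge0.
by rewrite opprB addrC subrK.
Qed.

(** After rescaling [k] to a contraction [k'], a root [s] of [1 - k' * k'] commutes with [k'], so
    [s + i k'] is unitary and [s], hence also [s * s], has norm at most 1. *)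
Lemma pos_sqr k : star k = k -> pos (k * k).
Proof.
move=> ks; split; first by rewrite starM ks.
(* The added 1 keeps the scale positive when [k] is 0. *)
have k0 := cnorm_ge0 k; pose r := cnorm k + 1; have r0 : 0 < r by rewrite /r; lra.
pose k' := r^-1%:C%C *: k; have kk' : k = r%:C%C *: k'.
  by rewrite scale_realA divff ?scale1r // gt_eqF.
have k's : star k' = k' by rewrite starZr ks.
have k'1 : cnorm k' <= 1.
  by rewrite cnormZr gtr0_norm ?invr_gt0 // mulrC ler_pdivrMr // /r; lra.
have [||s [ss s2 _ sc]] := @cstar_sqrt (k' * k'); first by rewrite starM k's.
  by apply: le_trans (cnormM _ _) _; have := cnorm_ge0 k'; nra.
have s1 : cnorm s <= 1.
  apply: (cnorm_le1_unitary ss k's); last by rewrite s2 subrK.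
  by rewrite sc // mulrA.
exists (r * r); first by rewrite mulr_ge0 // ltW.
rewrite kk' -scalemulAl -scalemulAr scale_realA -scalerBr -s2.
rewrite cnormZr ger0_norm; last first.
  by rewrite mulr_ge0 // ltW.
rewrite -[leRHS]mulr1 ler_wpM2l ?mulr_ge0 ?(ltW r0) //.
by have := cnormM s s; have := cnorm_ge0 s; nra.
Qed.

Lemma pos1 : pos 1.
Proof. by rewrite -[1]mulr1; apply: pos_sqr; rewrite star1. Qed.

(** A positive radius [r] of [h] gives [h / r = 1 - g] with [g] of norm at most 1, and the root of
    [1 - g] is scaled by [Num.sqrt r]. That root lies within 1 of the unit, which is positivity with
    radius 1. *)
Lemma pos_sqrt h : pos h -> exists s, [/\ star s = s, s * s = h, pos s &
  forall g, g * h = h * g -> g * s = s * g].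
Proof.
move=> hp; have hs := hp.1; have [r r1 hr] := pos_radius ler01 hp.
have r0 : 0 < r by lra.
pose g := r^-1%:C%C *: (r%:C%C *: (1 : A) - h).
have gE : 1 - g = r^-1%:C%C *: h.
  by rewrite /g scalerBr scale_realA mulVf ?gt_eqF // scale1r opprB addrC subrK.
have [||s [ss s2 s1 sc]] := @cstar_sqrt g.
- by rewrite starZr starB starZr star1 hs.
- by rewrite cnormZr gtr0_norm ?invr_gt0 // mulrC ler_pdivrMr // mul1r.
have r20 : 0 <= Num.sqrt r by exact: sqrtr_ge0.
have sp : pos s by split => //; exists 1 => //; rewrite scale1r.
exists ((Num.sqrt r)%:C%C *: s); split; [by rewrite starZr ss| |exact: posZ|].
- rewrite -scalemulAl -scalemulAr scale_realA -expr2 sqr_sqrtr ?(ltW r0) // s2 gE.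
  by rewrite scale_realA divff ?scale1r // gt_eqF.
- move=> k kh; rewrite -scalemulAl -scalemulAr sc // /g.
  by rewrite -scalemulAl -scalemulAr mulrBl mulrBr -scalemulAl -scalemulAr mul1r mulr1 kh.
Qed.

(** The roots of [h] and [1 - h] commute and their squares add up to 1, so they are the two parts of
    a unitary. *)
Lemma cnorm_pos_le1 h : pos h -> pos (1 - h) -> cnorm h <= 1.
Proof.
move=> /pos_sqrt[s [ss s2 _ sc]] /pos_sqrt[k [ks k2 _ kc]].
have s1 : cnorm s <= 1.
  apply: (cnorm_le1_unitary ss ks); last by rewrite s2 k2 addrC subrK.
  by apply: kc; rewrite mulrBr mulrBl mul1r mulr1 -s2 mulrA.
by rewrite -s2; have := cnormM s s; have := cnorm_ge0 s; nra.
Qed.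

Lemma pos_cnorm_le r h : 0 <= r -> pos h -> pos (r%:C%C *: (1 : A) - h) -> cnorm h <= r.
Proof.
(* Since [r] may be 0, division is by [e + r], which reduces the claim to [cnorm_pos_le1]. *)
move=> r0 hp rhp; apply/ler_addgt0Pl => e e0.
have re : 0 < e + r by lra.
have hE : h = (e + r)%:C%C *: ((e + r)^-1%:C%C *: h).
  by rewrite scale_realA divff ?scale1r // gt_eqF.
rewrite hE cnormZr gtr0_norm // -[leRHS]mulr1 ler_pM2l //.
apply: cnorm_pos_le1; first by apply: posZ => //; rewrite invr_ge0 ltW.
have -> : 1 - (e + r)^-1%:C%C *: h =
    (e + r)^-1%:C%C *: (e%:C%C *: (1 : A) + (r%:C%C *: (1 : A) - h)).
  by rewrite addrA -scalerDl -rmorphD scalerBr scale_realA mulVf ?scale1r // gt_eqF.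
apply: posZ; first by rewrite invr_ge0 ltW.
by apply: posD => //; apply: posZ pos1; exact: ltW.
Qed.

(** The scalar [cnorm (h + k)] minus [h] splits into [cnorm (h + k) - (h + k)] and [k], both
    positive. *)
Lemma cnorm_pos_leD h k : pos h -> pos k -> cnorm h <= cnorm (h + k).
Proof.
move=> hp kp; apply: pos_cnorm_le => //; first exact: cnorm_ge0.
have -> : (cnorm (h + k))%:C%C *: (1 : A) - h =
    ((cnorm (h + k))%:C%C *: (1 : A) - (h + k)) + k.
  by rewrite opprD addrA subrK.
by apply: posD => //; apply: pos_sub => //; rewrite starD hp.1 kp.1.
Qed.

Lemma sqr_eq0 x : star x = x -> x * x = 0 -> x = 0.
Proof.
move=> xs x2; apply: cnorm_eq0.
by have := cnorm_starM x; rewrite xs x2 cnorm0 => /esym/eqP; rewrite sqrf_eq0 => /eqP.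
Qed.

Lemma starM_eq0 z : star z * z = 0 -> z = 0.
Proof.
move=> z2; apply: cnorm_eq0.
by have := cnorm_starM z; rewrite z2 cnorm0 => /esym/eqP; rewrite sqrf_eq0 => /eqP.
Qed.

(** Here [2 y = a - i b] with [a] and [b] self-adjoint; the cross terms cancel in the sum, leaving
    [(a^2 + b^2) / 2]. *)
Lemma pos_starM_add y : pos (star y * y + y * star y).
Proof.
pose a := y + star y; pose b : A := 'i%C *: (y - star y).
have as_ : star a = a by rewrite starD starK addrC.
have bs : star b = b.
  by rewrite starZ starB starK conjii scaleNr -scalerN opprB.
have -> : star y * y + y * star y = (2^-1 : R)%:C%C *: (a * a + b * b).
  rewrite /b -scalemulAl -scalemulAr scalerA mulii scaleN1r.
  rewrite /a mulrDl mulrBl opprD opprK addrACA -mulrBr -mulrDr.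
  have -> : y + star y - (y - star y) = star y + star y.
    by rewrite opprB addrC addrA subrK.
  have -> : y + star y + (y - star y) = y + y by rewrite addrACA subrr addr0.
  by rewrite !mulrDr addrACA addr2Z scale_realA mulVf // scale1r addrC.
by apply: posZ; rewrite ?invr_ge0 //; apply: posD; exact: pos_sqr.
Qed.

Lemma posD_eq0 h k : pos h -> pos k -> h + k = 0 -> h = 0.
Proof.
move=> hp kp e; apply: cnorm_eq0; apply: le_anti; rewrite cnorm_ge0 andbT.
by have := cnorm_pos_leD hp kp; rewrite e cnorm0.
Qed.

(* With y = q z^*, both y^* y = - (z z^* )^2 and y y^* = - q^4, while
   y^* y + y y^* is a sum of squares of self-adjoint elements. *)
Lemma starM_opp_sqr_eq0 z q : star q = q -> star z * z = - (q * q) -> z = 0.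
Proof.
move=> qs zz; pose p := z * star z; pose y := q * star z.
have ps : star p = p by rewrite starM starK.
have q2s : star (q * q) = q * q by rewrite starM qs.
have sum0 : p * p + (q * q * (q * q) + (star y * y + y * star y)) = 0.
  have -> : star y * y = - (p * p).
    by rewrite /y starM starK qs mulrA -(mulrA z) -[q * q]opprK -zz mulrN mulNr /p !mulrA.
  have -> : y * star y = - (q * q * (q * q)).
    by rewrite /y starM starK qs !mulrA -(mulrA q) zz mulrN mulNr !mulrA.
  by rewrite addrCA -opprD addrA (addrC (p * p)) subrr.
have p0 : p = 0.
  apply: sqr_eq0 => //; apply: posD_eq0 sum0; first exact: pos_sqr.
  by apply: posD; [exact: pos_sqr | exact: pos_starM_add].
by rewrite -[z]starK; apply/eqP; rewrite -star0 (inj_eq (inv_inj starK)); apply/eqP;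
  apply: starM_eq0; rewrite starK.
Qed.

(* Let w = |h| for h = x^* x and v = w - h; then (x v)^* (x v) = - w v^2. *)
Lemma pos_starM x : pos (star x * x).
Proof.
pose h := star x * x; have hs : star h = h by rewrite starM starK.
have [w [ws w2 wp wc]] := pos_sqrt (pos_sqr hs).
have wh : w * h = h * w by rewrite -wc // !mulrA.
have [r [rs r2 _ rc]] := pos_sqrt wp.
pose v := w - h; have vs : star v = v by rewrite starB ws hs.
have vw : v * w = w * v by rewrite mulrBl mulrBr wh.
have rv : r * v = v * r by rewrite -rc.
have hv : h * v = - (w * v).
  apply/eqP; rewrite -subr_eq0 opprK -mulrDl /v mulrBr !mulrDl w2 wh.
  by rewrite [X in _ - X]addrC subrr.
have v2 : v * v = w * v + w * v by rewrite {1}/v mulrBl hv opprK.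
pose q := r * v; have qs : star q = q by rewrite starM rs vs.
have q2 : star (x * v) * (x * v) = - (q * q).
  rewrite starM vs -!mulrA (mulrA (star x)) -/h hv mulrN; congr (- _).
  by rewrite (mulrA v w) vw -r2 /q (mulrA v r) -rv !mulrA.
have xv0 := starM_opp_sqr_eq0 qs q2.
have q0 : q = 0.
  by apply: sqr_eq0 => //; apply/eqP; rewrite -oppr_eq0 -q2 xv0 mulr0.
(* As [w = r * r], the square of [v] is twice [r * q] and vanishes with [q]; then [h] equals the
   positive [w]. *)
have v0 : v = 0.
  by apply: sqr_eq0 => //; rewrite v2 -r2 -mulrA -/q q0 mulr0 addr0.
by rewrite -/h -(subr0_eq v0).
Qed.

End Positivity.

(** * The Hilbert module of columns *)

Section HilbertModule.
Variables (R : realType) (A : cstarAlgType R) (t : nat).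
Implicit Types (x y : 'cV[A]_t) (M N : 'M[A]_t) (a b : A) (c d r : R).

Definition ip x y : A := (adjmx x *m y) ord0 ord0.

(** The right action of A on the Hilbert module A^t, which commutes with left multiplication by
    matrices. Real scalars act through it as multiples of 1. *)
Definition mulcol x a : 'cV[A]_t := \col_i (x i ord0 * a).

Lemma ipE x y : ip x y = \sum_i star (x i ord0) * y i ord0.
Proof. by rewrite /ip mxE; apply: eq_bigr => i _; rewrite !mxE. Qed.

Lemma ip_star x y : star (ip x y) = ip y x.
Proof. by rewrite !ipE star_sum; apply: eq_bigr => i _; rewrite starM starK. Qed.

Lemma ipDr x y z : ip x (y + z) = ip x y + ip x z.
Proof. by rewrite /ip mulmxDr mxE. Qed.

Lemma ipNr x y : ip x (- y) = - ip x y.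
Proof. by rewrite /ip mulmxN mxE. Qed.

Lemma ipDl x y z : ip (y + z) x = ip y x + ip z x.
Proof. by rewrite -ip_star ipDr starD !ip_star. Qed.

Lemma ipNl x y : ip (- y) x = - ip y x.
Proof. by rewrite -ip_star ipNr starN !ip_star. Qed.

Lemma ip_mulr x y a : ip x (mulcol y a) = ip x y * a.
Proof. by rewrite !ipE mulr_suml; apply: eq_bigr => i _; rewrite mxE mulrA. Qed.

Lemma ip_mull x y a : ip (mulcol x a) y = star a * ip x y.
Proof. by rewrite -ip_star ip_mulr starM ip_star. Qed.

Lemma ip_adj x y M : ip x (M *m y) = ip (adjmx M *m x) y.
Proof. by rewrite /ip adjmxM adjmxK mulmxA. Qed.

Lemma pos_ip x : pos (ip x x).
Proof. by rewrite ipE; apply: pos_sum => i _; exact: pos_starM. Qed.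

Lemma colnorm_ge0 x : 0 <= colnorm x.
Proof. exact: sqrtr_ge0. Qed.

Lemma sqr_colnorm x : colnorm x ^+ 2 = cnorm (ip x x).
Proof. by rewrite sqr_sqrtr // cnorm_ge0. Qed.

(** Expand [<d, d>] for [d = r y - x c] with [c = <x, y>]. Adding the positive [c^* (r - <x, x>) c]
    removes [<x, x>] and leaves [r (r <y, y> - c^* c)]; monotonicity of the norm then bounds
    [c^* c]. *)
Lemma cauchy_schwarz_le x y r : 0 < r -> cnorm (ip x x) <= r ->
  cnorm (ip x y) ^+ 2 <= r * cnorm (ip y y).
Proof.
move=> r0 xr; pose c := ip x y.
pose d := mulcol y (r%:C%C *: (1 : A)) - mulcol x c.
have e1 : pos (star c * (r%:C%C *: (1 : A) - ip x x) * c).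
  have [s [ss s2 _ _]] := pos_sqrt (pos_sub (pos_ip x).1 xr).
  rewrite -s2 !mulrA -mulrA -{1}ss -starM; exact: pos_starM.
have e2 := posD e1 (pos_ip d).
have yy : ip (mulcol y (r%:C%C *: (1 : A))) (mulcol y (r%:C%C *: (1 : A))) =
    r%:C%C *: (r%:C%C *: ip y y).
  by rewrite ip_mulr ip_mull starZr star1 -scalemulAl -scalemulAr mul1r mulr1.
have xy : ip (mulcol x c) (mulcol y (r%:C%C *: (1 : A))) = r%:C%C *: (star c * c).
  by rewrite ip_mulr ip_mull -scalemulAr mulr1.
have yx : ip (mulcol y (r%:C%C *: (1 : A))) (mulcol x c) = r%:C%C *: (star c * c).
  by rewrite -ip_star xy starZr starM starK.
have xx : ip (mulcol x c) (mulcol x c) = star c * ip x x * c.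
  by rewrite ip_mulr ip_mull.
have e3 : star c * (r%:C%C *: (1 : A) - ip x x) * c + ip d d =
    r%:C%C *: (r%:C%C *: ip y y - star c * c).
  rewrite /d ipDr ipNr !ipDl !ipNl yy xy yx xx mulrBr mulrBl -scalemulAr mulr1.
  by rewrite -scalemulAl addrC subrK scalerBr.
have r_inv : 0 <= r^-1 by rewrite invr_ge0 ltW.
have := posZ r_inv e2; rewrite e3 scale_realA mulVf ?gt_eqF // scale1r => e4.
have := cnorm_pos_leD (pos_starM c) e4.
by rewrite addrC subrK cnorm_starM cnormZr gtr0_norm.
Qed.

Lemma cauchy_schwarz x y : cnorm (ip x y) <= colnorm x * colnorm y.
Proof.
rewrite -(@ler_pXn2r _ 2) ?nnegrE ?mulr_ge0 ?colnorm_ge0 ?cnorm_ge0 //.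
rewrite exprMn !sqr_colnorm; apply/ler_addgt0Pl => e e0.
have y0 := cnorm_ge0 (ip y y); have x0 := cnorm_ge0 (ip x x).
(* The radius must be positive, so [cnorm (ip x x)] is enlarged by some [f] with
   [f * cnorm (ip y y) <= e]. *)
pose f := e / (cnorm (ip y y) + 1).
have f0 : 0 < f by apply: divr_gt0 => //; lra.
apply: le_trans (@cauchy_schwarz_le x y (f + cnorm (ip x x)) _ _) _; try lra.
rewrite mulrDl lerD2r /f -mulrA ler_piMr ?(ltW e0) // mulrC ler_pdivrMr ?mul1r; lra.
Qed.

Lemma colnormD x y : colnorm (x + y) <= colnorm x + colnorm y.
Proof.
rewrite -(@ler_pXn2r _ 2) ?nnegrE ?addr_ge0 ?colnorm_ge0 //.
rewrite sqrrD !sqr_colnorm ipDr !ipDl.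
have := cnormD (ip x x + ip y x) (ip x y + ip y y).
have := cnormD (ip x x) (ip y x); have := cnormD (ip x y) (ip y y).
have := cauchy_schwarz x y; have := cauchy_schwarz y x; rewrite mulr2n; lra.
Qed.

(** The squared norm of an entry is the norm of one term in a sum of positive elements. *)
Lemma cnorm_entry x i : cnorm (x i ord0) <= colnorm x.
Proof.
rewrite -(@ler_pXn2r _ 2) ?nnegrE ?colnorm_ge0 ?cnorm_ge0 //.
rewrite sqr_colnorm -cnorm_starM ipE (bigD1 i) //=.
by apply: cnorm_pos_leD; [|apply: pos_sum => j _]; exact: pos_starM.
Qed.

Lemma colnorm_le_sum x : colnorm x <= \sum_i cnorm (x i ord0).
Proof.
have s0 : 0 <= \sum_i cnorm (x i ord0) by apply: sumr_ge0 => i _; exact: cnorm_ge0.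
rewrite -(@ler_pXn2r _ 2) ?nnegrE ?colnorm_ge0 //.
rewrite sqr_colnorm ipE; apply: le_trans (cnorm_sum _ _ _) _.
rewrite expr2 mulr_suml; apply: ler_sum => i _.
rewrite cnorm_starM expr2 ler_wpM2l ?cnorm_ge0 // (bigD1 i) //= lerDl.
by apply: sumr_ge0 => j _; exact: cnorm_ge0.
Qed.

Lemma colnorm0 : colnorm (0 : 'cV[A]_t) = 0.
Proof.
apply: le_anti; rewrite colnorm_ge0 andbT; apply: le_trans (colnorm_le_sum _) _.
by rewrite big1 // => i _; rewrite mxE cnorm0.
Qed.

Lemma colnorm_eq0 x : colnorm x = 0 -> x = 0.
Proof.
move=> x0; apply/matrixP => i j; rewrite mxE (ord1 j); apply: cnorm_eq0.
by apply: le_anti; rewrite cnorm_ge0 andbT -x0 cnorm_entry.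
Qed.

Lemma colnormN x : colnorm (- x) = colnorm x.
Proof. by rewrite /colnorm -?/(ip _ _) ipNr ipNl opprK. Qed.

Lemma colnorm_scale (u : R[i]) x : `|u| = 1 ->
  colnorm (map_mx ( *:%R u) x) = colnorm x.
Proof.
move=> u1; rewrite /colnorm -?/(ip _ _) !ipE; congr (Num.sqrt (cnorm _)).
apply: eq_bigr => i _; rewrite !mxE starZ -scalemulAl -scalemulAr scalerA.
by rewrite -[(_ * u)]mulrC -sqr_normc u1 expr1n scale1r.
Qed.

Lemma colnorm_mulr x r : 0 <= r -> colnorm (mulcol x (r%:C%C *: (1 : A))) = r * colnorm x.
Proof.
move=> r0; rewrite /colnorm -?/(ip _ _) ip_mulr ip_mull starZr star1.
rewrite -scalemulAl -!scalemulAr mulr1 mul1r scale_realA cnormZr ger0_norm ?mulr_ge0 //.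
by rewrite sqrtrM ?mulr_ge0 // -expr2 sqrtr_sqr ger0_norm.
Qed.

(* Asking for 0 <= c only matters when A^t = 0. *)
Definition opbound M c : Prop :=
  0 <= c /\ forall x, colnorm (M *m x) <= c * colnorm x.

Lemma opbound_le M c d : opbound M c -> c <= d -> opbound M d.
Proof.
move=> [c0 Mc] cd; split=> [|x]; first exact: le_trans cd.
by apply: le_trans (Mc x) _; rewrite ler_wpM2r ?colnorm_ge0.
Qed.

Lemma opboundD M N c d : opbound M c -> opbound N d -> opbound (M + N) (c + d).
Proof.
move=> [c0 Mc] [d0 Nd]; split=> [|x]; first exact: addr_ge0.
by rewrite mulmxDl mulrDl; apply: le_trans (colnormD _ _) (lerD (Mc x) (Nd x)).
Qed.

Lemma opboundM M N c d : opbound M c -> opbound N d -> opbound (M * N) (c * d).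
Proof.
move=> [c0 Mc] [d0 Nd]; split=> [|x]; first exact: mulr_ge0.
rewrite -mulmxA -mulrA; apply: le_trans (Mc _) _.
by rewrite ler_wpM2l.
Qed.

Lemma opboundN M c : opbound M c -> opbound (- M) c.
Proof. by move=> [c0 Mc]; split=> // x; rewrite mulNmx colnormN. Qed.

(** For [y = M^* x] one has [<y, y> = <x, M y>], so Cauchy-Schwarz bounds the squared norm of [y] by
    [c] times the norms of [x] and [y], and one factor cancels. *)
Lemma opbound_star M c : opbound M c -> opbound (star M) c.
Proof.
move=> [c0 Mc]; split=> // x; rewrite -[star M]/(adjmx M).
set y := adjmx M *m x.
have h : colnorm y ^+ 2 <= colnorm x * (c * colnorm y).
  rewrite sqr_colnorm {1}/y -ip_adj; apply: le_trans (cauchy_schwarz _ _) _.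
  by rewrite ler_wpM2l ?colnorm_ge0.
have [y0|y0] := eqVneq (colnorm y) 0; first by rewrite y0 mulr_ge0 ?colnorm_ge0.
have y_gt0 : 0 < colnorm y by rewrite lt_def y0 colnorm_ge0.
by rewrite -(ler_pM2r y_gt0) -expr2; apply: le_trans h _; rewrite mulrCA mulrA.
Qed.

Lemma opbound_scale (u : R[i]) M c : `|u| = 1 ->
  opbound M c -> opbound (map_mx ( *:%R u) M) c.
Proof.
move=> u1 [c0 Mc]; split=> // x.
suff -> : map_mx ( *:%R u) M *m x = map_mx ( *:%R u) (M *m x) by rewrite colnorm_scale.
apply/matrixP => i j; rewrite !mxE scaler_sumr; apply: eq_bigr => k _.
by rewrite mxE scalemulAl.
Qed.

(** A crude bound. Together with [opbound_entry] it compares operator bounds with norms of entries,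
    which carries completeness from A to its matrices. *)
Lemma opbound_sum_entries M : opbound M (\sum_i \sum_j cnorm (M i j)).
Proof.
split=> [|x]; first by do 2! apply: sumr_ge0 => ? _; exact: cnorm_ge0.
apply: le_trans (colnorm_le_sum _) _; rewrite mulr_suml; apply: ler_sum => i _.
rewrite mxE mulr_suml; apply: le_trans (cnorm_sum _ _ _) _; apply: ler_sum => j _.
by apply: le_trans (cnormM _ _) _; rewrite ler_wpM2l ?cnorm_ge0 ?cnorm_entry.
Qed.

Lemma opbound_entry M c i j : opbound M c -> cnorm (M i j) <= c.
Proof.
move=> [c0 Mc]; pose e : 'cV[A]_t := delta_mx j ord0.
have -> : M i j = (M *m e) i ord0.
  rewrite mxE (bigD1 j) //= big1 => [|k kj]; first by rewrite mxE !eqxx mulr1 addr0.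
  by rewrite mxE (negbTE kj) mulr0.
apply: le_trans (cnorm_entry _ _) _; apply: le_trans (Mc _) _.
rewrite -[leRHS]mulr1 ler_wpM2l //; apply: le_trans (colnorm_le_sum _) _.
rewrite (bigD1 j) //= big1 => [|k kj]; first by rewrite mxE !eqxx addr0 cnorm1_le1.
by rewrite mxE (negbTE kj) cnorm0.
Qed.

(** Limits are taken entry by entry and the [t * t] errors are summed, which gives the constant. *)
Lemma opbound_complete_bound :
  complete_bound opbound (((2^-1 : R)%:C%C *: (1 : A))%:M : 'M[A]_t) (t * t)%:R.
Proof.
split => //.
- by split=> // x; rewrite mul0mx colnorm0 mul0r.
- exact: opboundD.
- by move=> M N c d _; exact: opboundM.
- exact: opboundN.
- by move=> M c _; exact: opbound_star.
- exact: opbound_le.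
- move=> M; have Mc := opbound_sum_entries M.
  by exists (\sum_i \sum_j cnorm (M i j)); first by case: Mc.
- move=> M hM; apply/matrixP => i j; rewrite mxE; apply: cnorm_eq0.
  apply: le_anti; rewrite cnorm_ge0 andbT; apply/ler_addgt0Pl => e e0.
  by rewrite addr0; apply: opbound_entry; exact: hM.
- by rewrite -rmorphD /= addr2Z scale_realA divff // scale1r.
- move=> M; apply/matrixP => i j; rewrite -[_ * M]/(_ *m M) -[M * _]/(M *m _).
  rewrite mul_scalar_mx !mxE (bigD1 j) //= big1 => [|k kj].
    by rewrite mxE eqxx addr0 -scalemulAl -scalemulAr mulr1 mul1r.
  by rewrite mxE (negbTE kj) mulr0.
- apply/matrixP => i j; rewrite !mxE eq_sym.
  by case: eqP => _; rewrite ?mulr1n ?mulr0n ?star0 // starZr star1.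
- split=> [|x]; first by rewrite invr_ge0.
  rewrite -colnorm_mulr ?invr_ge0 // le_eqVlt; apply/orP; left; apply/eqP.
  congr colnorm; apply/matrixP => i j; rewrite mul_scalar_mx !mxE.
  by rewrite (ord1 j) -scalemulAl -scalemulAr mulr1 mul1r.
- move=> u q M hu hq.
  have hl i j : exists l, forall n, cnorm (l - u n i j) <= sup (range q) - q n.
    apply: (cauchy_limit _ hq) => n.
    by have := opbound_entry i j (hu n); rewrite !mxE.
  exists (\matrix_(i, j) sval (cid (hl i j))) => n.
  apply: opbound_le (opbound_sum_entries _) _.
  rewrite natrM -mulrA.
  have -> : t%:R * (t%:R * (sup (range q) - q n)) =
      \sum_(i < t) \sum_(j < t) (sup (range q) - q n).
    by rewrite !sumr_const card_ord !mulr_natl.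
  apply: ler_sum => i _; apply: ler_sum => j _; rewrite !mxE.
  by case: (cid (hl i j)) => l /=.
Qed.

End HilbertModule.

(** * Matrices as operators on columns *)

Section OperatorNorm.
Variables (R : realType) (A : cstarAlgType R) (t : nat).
Implicit Types (M N : 'M[A]_t) (x : 'cV[A]_t).

(** A column is brought into the unit ball by right multiplication with the inverse of its norm,
    which commutes with [M]; a column of norm 0 is 0. *)
Lemma opbound_mxcnorm M : (mxcnorm M <= 1)%E -> opbound M 1.
Proof.
move=> M1; split=> // x; rewrite mul1r.
have [x0|x0] := eqVneq (colnorm x) 0.
  by rewrite (colnorm_eq0 x0) mulmx0.
have x_gt0 : 0 < colnorm x by rewrite lt_def x0 colnorm_ge0.
have r0 : 0 <= (colnorm x)^-1 by rewrite invr_ge0 ltW.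
pose y := mulcol x ((colnorm x)^-1%:C%C *: (1 : A)).
have y1 : colnorm y <= 1 by rewrite colnorm_mulr // mulVf.
have : ((colnorm (M *m y))%:E <= 1)%E.
  by apply: le_trans M1; apply: ereal_sup_ubound; exists y.
have -> : M *m y = mulcol (M *m x) ((colnorm x)^-1%:C%C *: (1 : A)).
  apply/matrixP => i j; rewrite !mxE mulr_suml; apply: eq_bigr => k _.
  by rewrite mxE mulrA.
by rewrite lee_fin colnorm_mulr // mulrC ler_pdivrMr // mul1r.
Qed.

Lemma mxcnorm_le M c : opbound M c -> (mxcnorm M <= c%:E)%E.
Proof.
move=> [c0 Mc]; apply: ge_ereal_sup => _ [x /= x1 <-]; rewrite lee_fin.
by apply: le_trans (Mc x) _; rewrite -[leRHS]mulr1 ler_wpM2l.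
Qed.

Lemma opbound1 : opbound (1 : 'M[A]_t) 1.
Proof. by split=> // x; rewrite mul1mx mul1r. Qed.

(** Since [star M * M] is again a contraction, [ring_sqrt] applies in the matrix ring itself and
    gives a self-adjoint root. *)
Lemma opbound1_sqrt M : opbound M 1 ->
  exists N, 1 - star M * M = star N * N.
Proof.
move=> M1; have MM1 := opboundM (opbound_star M1) M1; rewrite mulr1 in MM1.
have [|N [Ns N2 _ _]] := ring_sqrt (opbound_complete_bound A t) _ MM1.
  by rewrite starM starK.
by exists N; rewrite Ns N2.
Qed.

(* The parallelogram identity gives
   4 - (M + N)^* (M + N) = (M - N)^* (M - N) + 2 (1 - M^* M) + 2 (1 - N^* N). *)
Lemma opbound1_sum_squares M N : opbound M 1 -> opbound N 1 ->
  exists s : seq 'M[A]_t,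
    1 *+ 4 - star (M + N) * (M + N) = \sum_(g <- s) star g * g.
Proof.
move=> /opbound1_sqrt[m hm] /opbound1_sqrt[n hn].
exists [:: M - N; m; m; n; n]; rewrite !big_cons big_nil addr0 -hm -hn.
have sumE : M + N + (M - N) = M + M by rewrite addrACA subrr addr0.
have difE : M + N - (M - N) = N + N by rewrite opprB addrC addrA subrK addrC.
have par : star (M + N) * (M + N) + star (M - N) * (M - N) =
    (star M * M + star N * N) *+ 2.
  rewrite starB starD (mulrDl (star M)) mulrBl addrACA -mulrDr sumE -mulrBr difE.
  by rewrite !mulrDr -!mulr2n -mulrnDl.
rewrite -[star (M - N) * _](addKr (star (M + N) * (M + N))) par.
have -> : 1 - star M * M + (1 - star M * M + (1 - star N * N + (1 - star N * N))) =
    1 *+ 4 - (star M * M + star N * N) *+ 2.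
  by rewrite addrA -!mulr2n !mulrnBl addrACA -mulrnDr -opprD -mulrnDl.
by rewrite [RHS]addrC addrCA subrK addrC.
Qed.

(** Positivity as an operator on A^t; in this form, closure under sums is immediate. *)
Definition mpos M : Prop := forall x, pos (ip x (M *m x)).

Lemma mpos_star N : mpos (star N * N).
Proof. by move=> x; rewrite -mulmxA ip_adj adjmxK; exact: pos_ip. Qed.

Lemma mpos_star_positive M : star_positive M -> mpos M.
Proof. by move=> [N ->]; exact: mpos_star. Qed.

Lemma mpos0 : mpos 0.
Proof. by move=> x; rewrite mul0mx /ip mulmx0 mxE; exact: pos0. Qed.

Lemma mposD M N : mpos M -> mpos N -> mpos (M + N).
Proof. by move=> Mp Np x; rewrite mulmxDl ipDr; exact: posD. Qed.

Lemma mposMn M n : mpos M -> mpos (M *+ n).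
Proof.
by move=> Mp; elim: n => [|n IH]; [exact: mpos0 | rewrite mulrS; exact: mposD].
Qed.

Lemma mpos_sum I (s : seq I) (F : I -> 'M[A]_t) :
  (forall i, mpos (F i)) -> mpos (\sum_(i <- s) F i).
Proof. by move=> Fp; elim/big_ind: _ => //; [exact: mpos0 | exact: mposD]. Qed.

Lemma mpos_scalar (a : A) : pos a -> mpos a%:M.
Proof.
move=> /pos_sqrt[s [ss <- _ _]] x; rewrite ipE; apply: pos_sum => i _.
rewrite mul_scalar_mx mxE !mulrA -mulrA -{1}ss -starM; exact: pos_starM.
Qed.

(** With [M = N^* N] the hypothesis reads [<N x, N x> <= c <x, x>], so [N] is bounded by the square
    root of [c], and so is its adjoint. *)
Lemma mpos_opbound M c : 0 <= c -> star_positive M ->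
  mpos ((c%:C%C *: (1 : A))%:M - M) -> opbound M c.
Proof.
move=> c0 [N ->] cp.
have Nc : opbound N (Num.sqrt c).
  split=> [|x]; first exact: sqrtr_ge0.
  rewrite -(@ler_pXn2r _ 2) ?nnegrE ?mulr_ge0 ?sqrtr_ge0 ?colnorm_ge0 //.
  rewrite exprMn (sqr_sqrtr c0) !sqr_colnorm.
  have := cnorm_pos_leD (pos_ip (N *m x)) (cp x).
  rewrite mulmxBl ipDr ipNr -mulmxA [ip x (star N *m _)]ip_adj adjmxK addrC subrK.
  have -> : (c%:C%C *: (1 : A))%:M *m x = mulcol x (c%:C%C *: (1 : A)).
    apply/matrixP => i j; rewrite mul_scalar_mx !mxE (ord1 j).
    by rewrite -scalemulAl -scalemulAr mul1r mulr1.
  by rewrite ip_mulr -scalemulAr mulr1 cnormZr ger0_norm.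
have := opboundM (opbound_star Nc) Nc.
by rewrite -expr2 sqr_sqrtr.
Qed.

End OperatorNorm.

(** * Polarization of sesquilinear maps on matrices *)

Section Polarization.
Variables (R : realType) (A B : cstarAlgType R) (t : nat).
Variables (G : 'M[A]_t -> 'M[A]_t -> 'M[B]_t).
Hypothesis GDl : forall X Y Z, G (X + Y) Z = G X Z + G Y Z.
Hypothesis GDr : forall X Y Z, G X (Y + Z) = G X Y + G X Z.
Hypothesis GZl : forall X Y, G (map_mx ( *:%R 'i%C) X) Y = - map_mx ( *:%R 'i%C) (G X Y).
Hypothesis GZr : forall X Y, G X (map_mx ( *:%R 'i%C) Y) = map_mx ( *:%R 'i%C) (G X Y).

Lemma normi : `|'i%C : R[i]| = 1.
Proof. by rewrite normc_def /= expr0n expr1n add0r sqrtr1. Qed.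

(** [4 G(X, Y)] is the sum of [u^-1 G(X + u Y, X + u Y)] over [u^4 = 1], four terms bounded by [c];
    each [u Y] is a contraction along with [Y]. *)
Lemma polarization_opbound X Y c :
  opbound Y 1 -> (forall Z, opbound Z 1 -> opbound (G (X + Z) (X + Z)) c) ->
  opbound (G X Y) c.
Proof.
move=> Y1 hZ; have Y2 := opbound_scale normi Y1.
have G0l Z : G 0 Z = 0 by apply: (addrI (G 0 Z)); rewrite -GDl !addr0.
have G0r Z : G Z 0 = 0 by apply: (addrI (G Z 0)); rewrite -GDr !addr0.
have GNl U V : G (- U) V = - G U V by apply: (addrI (G U V)); rewrite -GDl !subrr G0l.
have GNr U V : G U (- V) = - G U V by apply: (addrI (G U V)); rewrite -GDr !subrr G0r.
have dif Z : G (X + Z) (X + Z) - G (X - Z) (X - Z) = (G X Z + G Z X) *+ 2.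
  rewrite (GDl X Z) (GDl X (- Z)) GNl opprD opprK addrACA -GNr -!GDr.
  have -> : X + Z - (X - Z) = Z + Z by rewrite opprB addrC addrA subrK addrC.
  have -> : X + Z + (X - Z) = X + X by rewrite addrACA subrr addr0.
  by rewrite !GDr -!mulr2n -mulrnDl.
have bdif Z : opbound Z 1 -> opbound ((G X Z + G Z X) *+ 2) (c + c).
  move=> Z1; rewrite -dif; apply: opboundD; first exact: hZ.
  by apply: opboundN; apply: hZ; exact: opboundN.
(* In the difference at [Y] minus i times the difference at [i Y], the terms [G Y X] cancel and
   [G X Y] remains four times. *)
have := opboundD (bdif Y Y1) (opboundN (opbound_scale normi (bdif _ Y2))).
rewrite GZr GZl.
have -> : map_mx ( *:%R 'i%C) ((map_mx ( *:%R 'i%C) (G X Y) -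
    map_mx ( *:%R 'i%C) (G Y X)) *+ 2) = (G Y X - G X Y) *+ 2.
  apply/matrixP => i j; rewrite !mulr2n !mxE.
  by rewrite -!scalerBr -scalerDr scalerA mulii scaleN1r opprD opprB.
have -> : (G X Y + G Y X) *+ 2 - (G Y X - G X Y) *+ 2 = G X Y *+ 4.
  by rewrite -mulrnBl opprB addrACA subrr addr0 -mulr2n -mulrnA.
move=> b4; have hb := opbound_complete_bound B t.
have := opboundM (bnd_half hb) (opboundM (bnd_half hb) b4).
set h := (_)%:M.
have -> : h * (h * (G X Y *+ 4)) = G X Y.
  have hK Z : h * (Z *+ 2) = Z.
    by rewrite mulrnAr mulr2n -mulrDl (half_add hb) mul1r.
  by rewrite -[4%N]/(2 * 2)%N mulrnA !hK.
by move/opbound_le; apply; lra.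
Qed.

End Polarization.

(** * Amplifications *)

Section SandwichedAmplification.
Variables (R : realType) (A B : cstarAlgType R) (psi : A -> A -> B) (t : nat).
Hypothesis psi_linl : forall d, linear (psi^~ d).
Hypothesis psi_linr : forall b, linear (psi b).

(* The amplification of the trilinear map (a, b, c) |-> psi b (a * c), which is
   the shape that invariance gives to phi both for k = 3 and for k = 4. *)
Definition amp (X P Y : 'M[A]_t) : 'M[B]_t :=
  \matrix_(i, j) \sum_r \sum_s psi (P r s) (X i r * Y s j).

Let psiDl b b' d : psi (b + b') d = psi b d + psi b' d.
Proof. by have := psi_linl d 1 b b'; rewrite !scale1r. Qed.

Let psiDr b d d' : psi b (d + d') = psi b d + psi b d'.
Proof. by have := psi_linr b 1 d d'; rewrite !scale1r. Qed.

Let psi0l d : psi 0 d = 0.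
Proof. by apply: (addrI (psi 0 d)); rewrite -psiDl !addr0. Qed.

Let psi0r b : psi b 0 = 0.
Proof. by apply: (addrI (psi b 0)); rewrite -psiDr !addr0. Qed.

Let psiZl u b d : psi (u *: b) d = u *: psi b d.
Proof. by have := psi_linl d u b 0; rewrite !addr0 psi0l addr0. Qed.

Let psiZr u b d : psi b (u *: d) = u *: psi b d.
Proof. by have := psi_linr b u d 0; rewrite !addr0 psi0r addr0. Qed.

Lemma ampDl X X' P Y : amp (X + X') P Y = amp X P Y + amp X' P Y.
Proof.
apply/matrixP => i j; rewrite !mxE -big_split; apply: eq_bigr => r _.
by rewrite -big_split; apply: eq_bigr => s _; rewrite mxE mulrDl psiDr.
Qed.

Lemma ampDm X P P' Y : amp X (P + P') Y = amp X P Y + amp X P' Y.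
Proof.
apply/matrixP => i j; rewrite !mxE -big_split; apply: eq_bigr => r _.
by rewrite -big_split; apply: eq_bigr => s _; rewrite mxE psiDl.
Qed.

Lemma ampDr X P Y Y' : amp X P (Y + Y') = amp X P Y + amp X P Y'.
Proof.
apply/matrixP => i j; rewrite !mxE -big_split; apply: eq_bigr => r _.
by rewrite -big_split; apply: eq_bigr => s _; rewrite mxE mulrDr psiDr.
Qed.

Lemma ampZl u X P Y : amp (map_mx ( *:%R u) X) P Y = map_mx ( *:%R u) (amp X P Y).
Proof.
apply/matrixP => i j; rewrite !mxE scaler_sumr; apply: eq_bigr => r _.
by rewrite scaler_sumr; apply: eq_bigr => s _; rewrite mxE -scalemulAl psiZr.
Qed.

Lemma ampZm u X P Y : amp X (map_mx ( *:%R u) P) Y = map_mx ( *:%R u) (amp X P Y).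
Proof.
apply/matrixP => i j; rewrite !mxE scaler_sumr; apply: eq_bigr => r _.
by rewrite scaler_sumr; apply: eq_bigr => s _; rewrite mxE psiZl.
Qed.

Lemma ampZr u X P Y : amp X P (map_mx ( *:%R u) Y) = map_mx ( *:%R u) (amp X P Y).
Proof.
apply/matrixP => i j; rewrite !mxE scaler_sumr; apply: eq_bigr => r _.
by rewrite scaler_sumr; apply: eq_bigr => s _; rewrite mxE -scalemulAr psiZr.
Qed.

Lemma amp0l P Y : amp 0 P Y = 0.
Proof. by apply: (addrI (amp 0 P Y)); rewrite -ampDl !addr0. Qed.

Lemma amp0m X Y : amp X 0 Y = 0.
Proof. by apply: (addrI (amp X 0 Y)); rewrite -ampDm !addr0. Qed.

Lemma amp0r X P : amp X P 0 = 0.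
Proof. by apply: (addrI (amp X P 0)); rewrite -ampDr !addr0. Qed.

Lemma ampNl X P Y : amp (- X) P Y = - amp X P Y.
Proof. by apply: (addrI (amp X P Y)); rewrite -ampDl !subrr amp0l. Qed.

Lemma ampNm X P Y : amp X (- P) Y = - amp X P Y.
Proof. by apply: (addrI (amp X P Y)); rewrite -ampDm !subrr amp0m. Qed.

(** Only the terms with [r = s] survive, and they add up to an entry of [X * Y]. This lets outer
    factors be merged once the middle one is 1. *)
Lemma amp_mid1 X Y i j : amp X 1 Y i j = psi 1 ((X * Y) i j).
Proof.
have psi_sum (F : 'I_t -> A) : psi 1 (\sum_r F r) = \sum_r psi 1 (F r).
  exact: (big_morph _ (psiDr 1) (psi0r 1)).
rewrite !mxE psi_sum; apply: eq_bigr => r _; rewrite (bigD1 r) //= big1 => [|s sr].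
  by rewrite mxE eqxx addr0.
by rewrite mxE eq_sym (negbTE sr) psi0l.
Qed.

Lemma amp_mid1_mulr X Y : amp X 1 Y = amp 1 1 (X * Y).
Proof. by apply/matrixP => i j; rewrite !amp_mid1 mul1r. Qed.

Lemma amp111 : amp 1 1 1 = (psi 1 1)%:M.
Proof.
apply/matrixP => i j; rewrite amp_mid1 mul1r !mxE.
by case: eqP => _; rewrite ?psi0r.
Qed.

Hypothesis t_gt0 : (0 < t)%N.
Hypothesis amp_pos :
  forall P Y, star_positive (amp (star Y) (star P * P) Y).

Let c := cnorm (psi 1 1).

Lemma star_positive_amp111 : star_positive (amp 1 1 1).
Proof. by have := amp_pos 1 1; rewrite star1 mulr1. Qed.

(** The element is a diagonal entry of some [star N * N]; an index exists because [t] is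
    positive. *)
Lemma star_psi11 : star (psi 1 1) = psi 1 1.
Proof.
have [N hN] := star_positive_amp111; pose i := Ordinal t_gt0.
have := congr1 (fun M : 'M[B]_t => M i i) hN.
rewrite amp111 !mxE eqxx mulr1n => ->; rewrite star_sum; apply: eq_bigr => k _.
by rewrite !mxE starM starK.
Qed.

Lemma opbound_amp_square X P1 P2 Y1 Y2 : X = star Y1 + star Y2 ->
    opbound P1 1 -> opbound P2 1 -> opbound Y1 1 -> opbound Y2 1 ->
  opbound (amp X (star (P1 + P2) * (P1 + P2)) (Y1 + Y2)) (16 * c).
Proof.
rewrite -starD => -> P1b P2b Y1b Y2b; set P := P1 + P2; set Y := Y1 + Y2.
apply: mpos_opbound; [by rewrite mulr_ge0 ?cnorm_ge0 | exact: amp_pos |].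
have [sP hP] := opbound1_sum_squares P1b P2b.
have [sY hY] := opbound1_sum_squares Y1b Y2b.
(* By linearity in the middle, [4 - P^* P] as a sum of squares turns the difference into a sum of
   positive values. *)
have mid : mpos (amp (star Y) 1 Y *+ 4 - amp (star Y) (star P * P) Y).
  rewrite -ampNm.
  have -> : amp (star Y) 1 Y *+ 4 = amp (star Y) (1 *+ 4) Y.
    by rewrite !mulrS !mulr0n !ampDm amp0m.
  rewrite -ampDm hP (big_morph (fun Q => amp (star Y) Q Y)
    (fun Q Q' => ampDm _ Q Q' _) (amp0m _ _)).
  by apply: mpos_sum => g; apply: mpos_star_positive; exact: amp_pos.
(* Merging the outer factors puts [4 - Y^* Y] in the last place; each of its squares [g^* g] is then
   split back into outer factors [g^*] and [g]. *)
have out : mpos (amp 1 1 1 *+ 4 - amp (star Y) 1 Y).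
  rewrite (amp_mid1_mulr (star Y)).
  have -> : amp 1 1 1 *+ 4 - amp 1 1 (star Y * Y) = amp 1 1 (1 *+ 4 - star Y * Y).
    rewrite ampDr !mulrS !mulr0n !ampDr amp0r; congr (_ + _).
    by apply: (addrI (amp 1 1 (star Y * Y))); rewrite -ampDr !subrr amp0r.
  rewrite hY (big_morph _ (ampDr 1 1) (amp0r 1 1)).
  apply: mpos_sum => g; rewrite -amp_mid1_mulr; apply: mpos_star_positive.
  by have := amp_pos 1 g; rewrite star1 mulr1.
have top : mpos ((c%:C%C *: (1 : B) - psi 1 1)%:M *+ 16 : 'M[B]_t).
  by apply: mposMn; apply: mpos_scalar; apply: pos_sub => //; exact: star_psi11.
(* The sum of [top], four times [out] and [mid] telescopes to
   [16 c - amp (star Y) (star P * P) Y]. *)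
have := mposD top (mposD (mposMn 4 out) mid).
rewrite mulrnBl [X in mpos (_ + X)]addrA subrK -mulrnA raddfB /= mulrnBl amp111.
rewrite addrA subrK.
suff -> : ((16 * c)%:C%C *: (1 : B))%:M = (c%:C%C *: (1 : B))%:M *+ 16 :> 'M[B]_t by [].
by rewrite -raddfMn /= scalerMnl mulr_natl rmorphMn.
Qed.

Lemma amp_opbound X P Y : opbound X 1 -> opbound P 1 -> opbound Y 1 ->
  opbound (amp X P Y) (16 * c).
Proof.
move=> Xb Pb Yb; rewrite -[X]starK.
have star_i (M : 'M[A]_t) : star (map_mx ( *:%R 'i%C) M) = - map_mx ( *:%R 'i%C) (star M).
  by apply/matrixP => i j; rewrite !mxE starZ conjii scaleNr.
apply: (@polarization_opbound _ _ _ _ (fun U V => amp (star U) P V)) => //.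
- by move=> U V W; rewrite starD ampDl.
- by move=> U V W; rewrite ampDr.
- by move=> U V; rewrite star_i ampNl ampZl.
- by move=> U V; rewrite ampZr.
(* Second polarization, at the pair [1], [P], with the outer factors fixed: the middle factor is
   read as [star 1 * P]. *)
move=> Y2 Y2b; rewrite -[P]mul1r -{1}(star1 'M[A]_t).
apply: (@polarization_opbound _ _ _ _
  (fun U V => amp (star (star X + Y2)) (star U * V) (star X + Y2))) => //.
- by move=> U V W; rewrite (starD U) mulrDl ampDm.
- by move=> U V W; rewrite mulrDr ampDm.
- move=> U V; rewrite star_i mulNr ampNm -ampZm; congr (- amp _ _ _).
  apply/matrixP => i j; rewrite !mxE scaler_sumr; apply: eq_bigr => k _.
  by rewrite !mxE scalemulAl.
- move=> U V; rewrite -ampZm; congr (amp _ _ _).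
  apply/matrixP => i j; rewrite !mxE scaler_sumr; apply: eq_bigr => k _.
  by rewrite !mxE scalemulAr.
move=> P2 P2b; apply: opbound_amp_square => //; first by rewrite starD.
- exact: opbound1.
- exact: opbound_star.
Qed.

End SandwichedAmplification.

(** * Sums over index tuples and the passage to the cb-norm *)

Lemma sum_tuple_cons (V : nmodType) (T : finType) n (F : n.+1.-tuple T -> V) :
  \sum_r F r = \sum_x \sum_(r : n.-tuple T) F [tuple of x :: r].
Proof.
rewrite pair_bigA /=; apply: (reindex (fun p : T * n.-tuple T => [tuple of p.1 :: p.2])).
exists (fun r => (thead r, [tuple of behead r])) => [[x r] _|r _] /=.
  by rewrite theadE; congr pair; apply: val_inj.
by rewrite [RHS]tuple_eta.
Qed.

Lemma sum_tuple0 (V : nmodType) (T : finType) (F : 0.-tuple T -> V) :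
  \sum_r F r = F [tuple].
Proof. by apply: big_pred1 => r; apply/esym/eqP; exact: tuple0. Qed.

Lemma bounded_of_amplification (R : realType) (A B : cstarAlgType R) (k : nat)
    (phi : {ffun 'I_k -> A} -> B) (c : R) :
  (forall t (M : {ffun 'I_k -> 'M[A]_t}), (0 < t)%N ->
     (forall l, opbound (M l) 1) -> opbound (amplification phi M) c) ->
  completely_bounded phi /\ (cbnorm phi <= c%:E)%E.
Proof.
move=> hphi; have le : (cbnorm phi <= c%:E)%E.
  apply: ge_ereal_sup => _ [t /= t0 <-]; apply: ge_ereal_sup => _ [M /= M1 <-].
  by apply: mxcnorm_le; apply: hphi => // l; exact: opbound_mxcnorm.
by split=> //; apply: le_lt_trans le (ltry _).
Qed.

(** * The trilinear and quadrilinear cases *)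

Section Arity.
Variables (R : realType) (A B : cstarAlgType R).

(** On an explicit list of arguments [set_nth] computes, so linearity of [psi] in each place follows
    by conversion. *)
Lemma multilinear_nth k (phi : {ffun 'I_k -> A} -> B) (s : seq A) (i : 'I_k) :
  multilinear phi -> size s = k ->
  linear (fun x => phi [ffun l : 'I_k => nth 0 (set_nth 0 s i x) l]).
Proof.
move=> lin sk u x y; have := lin i [ffun l : 'I_k => nth 0 s l] u x y.
suff e z : finfun [eta [ffun l : 'I_k => nth 0 s l] with i |-> z] =
    [ffun l : 'I_k => nth 0 (set_nth 0 s i z) l] by rewrite !e.
by apply/ffunP => l; rewrite !ffunE nth_set_nth /= ffunE.
Qed.

Lemma bounded_invariant3 (phi : {ffun 'I_3 -> A} -> B) :
  multilinear phi -> invariant_map phi -> completely_positive phi ->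
  completely_bounded phi /\
  (cbnorm phi <= (2 ^+ 4 * cnorm (phi [ffun=> 1]))%:E)%E.
Proof.
move=> lin inv cp.
pose psi b d := phi [ffun l : 'I_3 => nth 0 [:: 1; b; d] l].
have psiE a b d : phi [ffun l : 'I_3 => nth 0 [:: a; b; d] l] = psi b (a * d).
  (* Invariance at [(1, b, d)] carries the multiplier [a] from the first place to the last. *)
  have := inv [ffun l : 'I_3 => nth 0 [:: 1; b; d] l] [ffun=> a].
  congr (phi _ = phi _); apply/ffunP => -[[|[|[|//]]] ?]; rewrite !ffunE /= ?mul1r //.
have ampE t (M : {ffun 'I_3 -> 'M[A]_t}) : amplification phi M =
    amp psi (M (inord 0)) (M (inord 1)) (M (inord 2)).
  apply/matrixP => i j; rewrite !mxE sum_tuple_cons; apply: eq_bigr => r _.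
  rewrite sum_tuple_cons; apply: eq_bigr => s _; rewrite sum_tuple0 -psiE.
  congr phi; apply/ffunP => -[[|[|[|//]]] hl]; rewrite !ffunE /=;
    by congr (M _ _ _); apply/val_inj; rewrite /= inordK.
have phi1 : phi [ffun=> 1] = psi 1 1.
  by congr phi; apply/ffunP => -[[|[|[|//]]] hl]; rewrite !ffunE.
apply: bounded_of_amplification => t M t0 M1; rewrite ampE phi1 -natrX.
apply: amp_opbound => //.
- by move=> d u x y; exact: (@multilinear_nth _ _ [:: 1; 1; d]
    (Ordinal (isT : (1 < 3)%N)) lin erefl u x y).
- by move=> b u x y; exact: (@multilinear_nth _ _ [:: 1; b; 1]
    (Ordinal (isT : (2 < 3)%N)) lin erefl u x y).
move=> P Y.
(* This triple is symmetric with a positive middle entry, as positivity for odd arity demands. *)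
have := cp t t0 [ffun l : 'I_3 => nth 0 [:: star Y; star P * P; Y] l].
rewrite ampE !ffunE !inordK //=; apply.
- move=> [[|[|[|//]]] hl]; rewrite !ffunE /= ?starK //.
  by rewrite starM starK.
- by move=> _ [[|[|[|//]]] hl] //; rewrite ffunE /=; exists P.
Qed.

Lemma bounded_invariant4 (phi : {ffun 'I_4 -> A} -> B) :
  multilinear phi -> invariant_map phi -> completely_positive phi ->
  completely_bounded phi /\
  (cbnorm phi <= (2 ^+ 4 * cnorm (phi [ffun=> 1]))%:E)%E.
Proof.
move=> lin inv cp.
pose psi b d := phi [ffun l : 'I_4 => nth 0 [:: 1; 1; b; d] l].
have psiE a b b' d :
    phi [ffun l : 'I_4 => nth 0 [:: a; b; b'; d] l] = psi (b * b') (a * d).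
  (* Invariance at [(1, 1, b', d)] with multipliers [a], [b] equates the values at [(a, b, b', d)]
     and [(1, 1, b b', a d)]. *)
  have := inv [ffun l : 'I_4 => nth 0 [:: 1; 1; b'; d] l]
              [ffun l : 'I_4 => nth 0 [:: a; b] l].
  congr (phi _ = phi _); apply/ffunP => -[[|[|[|[|//]]]] ?]; rewrite !ffunE /= ?mul1r //.
have psi_linl d : linear (psi^~ d).
  move=> u x y; exact: (@multilinear_nth _ _ [:: 1; 1; 1; d]
    (Ordinal (isT : (2 < 4)%N)) lin erefl u x y).
have psi_linr b : linear (psi b).
  move=> u x y; exact: (@multilinear_nth _ _ [:: 1; 1; b; 1]
    (Ordinal (isT : (3 < 4)%N)) lin erefl u x y).
have psi_sum d (I : finType) (F : I -> A) : psi (\sum_i F i) d = \sum_i psi (F i) d.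
  have psiDl b b' : psi (b + b') d = psi b d + psi b' d.
    by have := psi_linl d 1 b b'; rewrite !scale1r.
  apply: (big_morph (psi^~ d) psiDl).
  by apply: (addrI (psi 0 d)); rewrite -psiDl !addr0.
have ampE t (M : {ffun 'I_4 -> 'M[A]_t}) : amplification phi M =
    amp psi (M (inord 0)) (M (inord 1) * M (inord 2)) (M (inord 3)).
  apply/matrixP => i j; rewrite !mxE sum_tuple_cons; apply: eq_bigr => r _.
  (* The index [s] between the two middle factors is moved innermost and absorbed, by additivity of
     [psi], into their matrix product. *)
  transitivity (\sum_s \sum_q
      psi (M (inord 1) r s * M (inord 2) s q) (M (inord 0) i r * M (inord 3) q j)).
    rewrite sum_tuple_cons; apply: eq_bigr => s _.
    rewrite sum_tuple_cons; apply: eq_bigr => q _; rewrite sum_tuple0 -psiE.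
    congr phi; apply/ffunP => -[[|[|[|[|//]]]] hl]; rewrite !ffunE /=;
      by congr (M _ _ _); apply/val_inj; rewrite /= inordK.
  by rewrite exchange_big; apply: eq_bigr => q _; rewrite mxE psi_sum.
have phi1 : phi [ffun=> 1] = psi 1 1.
  by congr phi; apply/ffunP => -[[|[|[|[|//]]]] hl]; rewrite !ffunE.
apply: bounded_of_amplification => t M t0 M1; rewrite ampE phi1 -natrX.
have M12 := opboundM (M1 (inord 1)) (M1 (inord 2)); rewrite mulr1 in M12.
apply: amp_opbound => //.
move=> P Y.
(* This quadruple is symmetric, and its middle entries multiply to [star P * P]. *)
have := cp t t0 [ffun l : 'I_4 => nth 0 [:: star Y; star P; P; Y] l].
rewrite ampE !ffunE !inordK //=; apply=> //.
by move=> [[|[|[|[|//]]]] hl]; rewrite !ffunE /= ?starK.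
Qed.

End Arity.

Theorem proposition2p5 (R : realType) (A B : cstarAlgType R) (k : nat)
    (hk : (1 <= k)%N) (phi : {ffun 'I_k -> A} -> B)
    (phi_multilinear : multilinear phi)
    (phi_invariant : invariant_map phi)
    (phi_cp : completely_positive phi) :
  (k = 3%N -> completely_bounded phi /\
     (cbnorm phi <= (2 ^+ 4 * cnorm (phi [ffun=> 1]))%:E)%E) /\
  (k = 4%N -> completely_bounded phi /\
     (cbnorm phi <= (2 ^+ 4 * cnorm (phi [ffun=> 1]))%:E)%E).
Proof.
by split=> k_eq; subst k; [exact: bounded_invariant3 | exact: bounded_invariant4].
Qed.
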